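(* Let $\mu$ be a compactly supported probability measure and let $c>0$. Then, as formal power series in one variable, $$(c\,M_\mu)\star Zeta = c\,\big(M_{\mu\boxtimes\mu_c}\big).$$
   Context: For a probability measure (or moment sequence) $\mu$ with moments $(m_k)_{k\ge1}$, $M_\mu(z)=\sum_{k\ge1}m_kz^k$ is its moment series. $NC(m)$ is the set of noncrossing partitions of $\{1,\dots,m\}$, and $K(\pi)$ is the Kreweras complement of $\pi\in NC(m)$. The free cumulants $(\kappa_k)$ of $\mu$ are determined by $m_k=\sum_{\pi\in NC(k)}\prod_{B\in\pi}\kappa_{|B|}$, and $R_\mu(z)=\sum_{k\ge1}\kappa_kz^k$. For power series $f=\sum_{k\ge1}f_kz^k$ and $g=\sum_{k\ge1}g_kz^k$ the boxed convolution $f\star g$ is the power series with $m$-th coefficient $\sum_{\pi\in NC(m)}\prod_{B\in\pi}f_{|B|}\prod_{C\in K(\pi)}g_{|C|}$. $Zeta(z)=\sum_{k\ge1}z^k$. Here $cf$ is the ordinary scalar multiple of $f$. Multiplicative free convolution $\boxtimes$ is the distribution (moment sequence) of a product of two free random variables with the given distributions; equivalently $R_{\mu\boxtimes\nu}=R_\mu\star R_\nu$. $\mu_c$ is the Marchenko–Pastur law with parameter $c$: the compactly supported probability measure whose $k$-th free cumulant is $c^{k-1}$ for all $k\ge1$. *)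

(* Defs.v *)
From HB Require Import structures.
From mathcomp Require Import all_boot all_order all_algebra.

Set Implicit Arguments.
Unset Strict Implicit.
Unset Printing Implicit Defensive.

Import Order.TTheory GRing.Theory Num.Theory.
Local Open Scope ring_scope.

(** * Noncrossing partitions of [{0, ..., m-1}] and Kreweras complement *)

Section Noncrossing.
Local Open Scope nat_scope.

Definition noncrossing (n : nat) (P : {set {set 'I_n}}) : bool :=
  [forall B in P, forall C in P,
     forall a in B, forall b in C, forall c in B, forall d in C,
       [&& a < b, b < c & c < d] ==> (B == C)].

Definition NC (n : nat) : {set {set {set 'I_n}}} :=
  [set P | partition P [set: 'I_n] & noncrossing P].

Fact even_pos_subproof (m : nat) (i : 'I_m) : i.*2 < m.*2.
Proof. by rewrite ltn_double. Qed.

Fact odd_pos_subproof (m : nat) (i : 'I_m) : i.*2.+1 < m.*2.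
Proof. by rewrite ltn_Sdouble. Qed.

Definition even_pos (m : nat) (i : 'I_m) : 'I_m.*2 :=
  Ordinal (even_pos_subproof i).
Definition odd_pos (m : nat) (i : 'I_m) : 'I_m.*2 :=
  Ordinal (odd_pos_subproof i).

(** [P] on the plain points and [Q] on the barred points of
    [0 < 0' < 1 < 1' < ... < m-1 < (m-1)'], relabelled in increasing order. *)
Definition interleave (m : nat) (P Q : {set {set 'I_m}}) :
    {set {set 'I_m.*2}} :=
  [set (@even_pos m) @: B | B : {set 'I_m} in P]
    :|: [set (@odd_pos m) @: C | C : {set 'I_m} in Q].

Definition refines (m : nat) (P Q : {set {set 'I_m}}) : bool :=
  [forall B in P, exists C in Q, B \subset C].

(** [Q] is the coarsest noncrossing partition whose union with [P] is
    noncrossing. *)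
Definition is_kreweras (m : nat) (P Q : {set {set 'I_m}}) : bool :=
  [&& Q \in NC m, noncrossing (interleave P Q) &
      [forall S in NC m, noncrossing (interleave P S) ==> refines S Q]].

(** The default [set0] is never used when [P \in NC m], see [krewerasP]. *)
Definition kreweras (m : nat) (P : {set {set 'I_m}}) : {set {set 'I_m}} :=
  odflt set0 [pick Q | is_kreweras P Q].

Lemma noncrossingP (n : nat) (P : {set {set 'I_n}}) :
  reflect (forall (B C : {set 'I_n}) (a b c d : 'I_n), B \in P -> C \in P ->
             a \in B -> b \in C -> c \in B -> d \in C ->
             a < b -> b < c -> c < d -> B = C)
          (noncrossing P).
Proof.
apply: (iffP idP) => [H B C a b c d BP CP aB bC cB dC ab bc cd|H].
  apply/eqP; move/forall_inP/(_ _ BP)/forall_inP/(_ _ CP): H.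
  move=> /forall_inP/(_ _ aB)/forall_inP/(_ _ bC)/forall_inP/(_ _ cB).
  by move=> /forall_inP/(_ _ dC); rewrite ab bc cd.
apply/forall_inP => B BP; apply/forall_inP => C CP.
apply/forall_inP => a aB; apply/forall_inP => b bC.
apply/forall_inP => c cB; apply/forall_inP => d dC.
by apply/implyP => /and3P[ab bc cd]; apply/eqP; apply: H ab bc cd.
Qed.

Section KrewerasExists.
Variables (m : nat) (P : {set {set 'I_m}}).
Hypothesis NCP : P \in NC m.

Let partP : partition P [set: 'I_m].
Proof. by move: NCP; rewrite inE => /andP[]. Qed.

Let ncP : noncrossing P.
Proof. by move: NCP; rewrite inE => /andP[]. Qed.

(** pairs of points of one block of [P] lying on both sides of [i'] *)
Let cut (i : 'I_m) : {set 'I_m * 'I_m} :=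
  [set u | [exists B in P, (u.1 \in B) && (u.2 \in B)]
             & (u.1 <= i) && (i < u.2)].

Let K := preim_partition cut [set: 'I_m].

Let partK : partition K [set: 'I_m].
Proof. exact: preim_partitionP. Qed.

Let K_cut (C : {set 'I_m}) i j :
  C \in K -> i \in C -> j \in C -> cut i = cut j.
Proof.
move=> CK iC jC; have /and3P[/eqP _ tK _] := partK.
have e : pblock K i = pblock K j.
  by rewrite (def_pblock tK CK iC) (def_pblock tK CK jC).
have: j \in pblock K i by rewrite (def_pblock tK CK iC).
rewrite pblock_equivalence_partition ?inE //; first by move/eqP.
by move=> x y z _ _ _; split=> // /eqP ->.
Qed.

Let cut_K i j : cut i = cut j -> j \in pblock K i.
Proof.
move=> e; rewrite pblock_equivalence_partition ?inE ?e //.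
by move=> x y z _ _ _; split=> // /eqP ->.
Qed.

Let in_cut i x y B : B \in P -> x \in B -> y \in B ->
  ((x, y) \in cut i) = (x <= i < y).
Proof.
move=> BP xB yB; rewrite inE /=.
suff -> : [exists B in P, (x \in B) && (y \in B)] by [].
by apply/exists_inP; exists B; rewrite // xB.
Qed.

Let ncK : noncrossing K.
Proof.
apply/noncrossingP => C D i k j l CK DK iC kD jC lD ik kj jl.
have eij := K_cut CK iC jC; have ekl := K_cut DK kD lD.
have /and3P[_ tK _] := partK.
rewrite -(def_pblock tK CK iC) -(def_pblock tK DK kD).
apply/esym; apply: same_pblock => //; apply: cut_K; apply/setP => -[x y].
apply/idP/idP => xy.
  have xy' : (x, y) \in cut j by rewrite -eij.
  move: (xy); rewrite inE => /andP[/exists_inP[B BP /andP[/= xB yB]] _].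
  move: xy xy'; rewrite !(in_cut _ BP xB yB) => /andP[xi _] /andP[_ jy].
  by rewrite (leq_trans xi (ltnW ik)) (ltn_trans kj jy).
have xy' : (x, y) \in cut l by rewrite -ekl.
move: (xy); rewrite inE => /andP[/exists_inP[B BP /andP[/= xB yB]] _].
have : (x, y) \in cut j.
  move: xy xy'; rewrite !(in_cut _ BP xB yB) => /andP[xk _] /andP[_ ly].
  by rewrite (leq_trans xk (ltnW kj)) (ltn_trans jl ly).
by rewrite -eij.
Qed.

Let ncPK : noncrossing (interleave P K).
Proof.
apply/noncrossingP => B' C' a b c d.
case/setUP=> /imsetP[B BP ->]; case/setUP=> /imsetP[C CP ->].
- move=> /imsetP[x xB ->] /imsetP[y yC ->] /imsetP[z zB ->] /imsetP[t tC ->].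
  rewrite /= !ltn_double => xy yz zt.
  by move/noncrossingP: ncP => H; rewrite (H B C x y z t BP CP xB yC zB tC xy yz zt).
- move=> /imsetP[x xB ->] /imsetP[i iC ->] /imsetP[y yB ->] /imsetP[j jC ->].
  rewrite /= ltnS leq_double ltn_Sdouble ltnS leq_double => xi iy yj.
  have := K_cut CP iC jC => /setP/(_ (x, y)).
  by rewrite !(in_cut _ BP xB yB) xi iy /= [j < y]ltnNge yj andbF.
- move=> /imsetP[i iB ->] /imsetP[x xC ->] /imsetP[j jB ->] /imsetP[y yC ->].
  rewrite /= ltnS leq_double !ltn_Sdouble => ix xj jy.
  have := K_cut BP iB jB => /setP/(_ (x, y)).
  by rewrite !(in_cut _ CP xC yC) xj jy /= [x <= i]leqNgt ix.
- move=> /imsetP[x xB ->] /imsetP[y yC ->] /imsetP[z zB ->] /imsetP[t tC ->].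
  rewrite /= !ltnS !ltn_double => xy yz zt.
  by move/noncrossingP: ncK => H; rewrite (H B C x y z t BP CP xB yC zB tC xy yz zt).
Qed.

Let maxK (S : {set {set 'I_m}}) :
  S \in NC m -> noncrossing (interleave P S) -> refines S K.
Proof.
rewrite inE => /andP[/and3P[_ tS S0] _] /noncrossingP ncPS.
apply/forall_inP => D DS.
have sub (i j : 'I_m) : i < j -> i \in D -> j \in D -> cut i = cut j.
  move=> ij iD jD; apply/setP => -[x y].
  have cr B : B \in P -> (@even_pos m) @: B = (@odd_pos m) @: D :> {set 'I_m.*2} ->
      x \in B -> False.
    move=> BP e xB; have: even_pos x \in (@odd_pos m) @: D by rewrite -e imset_f.
    by case/imsetP=> z _ /(congr1 (odd \o val)) /=; rewrite !odd_double.
  have mP B : B \in P -> (@even_pos m) @: B \in interleave P S.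
    by move=> BP; rewrite inE imset_f.
  have mS : (@odd_pos m) @: D \in interleave P S by rewrite inE [X in _ || X]imset_f ?orbT.
  apply/idP/idP=> xy; move: (xy);
    rewrite inE => /andP[/exists_inP[B BP /andP[/= xB yB]] _];
    move: xy; rewrite !(in_cut _ BP xB yB) => /andP[h1 h2].
    rewrite (leq_trans h1 (ltnW ij)) /= ltnNge; apply/negP => yj.
    apply: (cr B) => //.
    apply: (ncPS _ _ (even_pos x) (odd_pos i) (even_pos y) (odd_pos j));
      rewrite ?imset_f ?mP //= ?ltnS ?leq_double ?ltn_Sdouble //.
  rewrite (ltn_trans ij h2) andbT leqNgt; apply/negP => ix.
  apply: (cr B) => //; apply/esym.
  apply: (ncPS _ _ (odd_pos i) (even_pos x) (odd_pos j) (even_pos y));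
    rewrite ?imset_f ?mP //= ?ltnS ?leq_double ?ltn_Sdouble //.
have [i iD] : exists i, i \in D.
  by apply/set0Pn; apply: contraNneq S0 => <-.
have /and3P[/eqP cK tK _] := partK.
apply/exists_inP; exists (pblock K i); first by rewrite pblock_mem // cK inE.
apply/subsetP => j jD; apply: cut_K.
by case: (ltngtP i j) => [/sub->|/sub->|/val_inj->].
Qed.

Lemma krewerasP : is_kreweras P (kreweras P).
Proof.
rewrite /kreweras; case: pickP => //= /(_ K) /negP[].
apply/and3P; split=> //; first by rewrite inE partK ncK.
by apply/forall_inP => S SN; apply/implyP; apply: maxK.
Qed.

End KrewerasExists.
End Noncrossing.

(** * Formal power series without constant term

    [f : nat -> K] stands for [\sum_(k >= 1) f k z^k]; all the series built
    below vanish at index [0]. *)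

Section Series.
Variable K : comNzRingType.

Definition zeta_series : nat -> K := fun k => (k != 0%N)%:R.

Definition moment_series (m : nat -> K) : nat -> K :=
  fun k => if k == 0%N then 0 else m k.

Definition scale_series (c : K) (f : nat -> K) : nat -> K := fun k => c * f k.

Definition boxed_conv (f g : nat -> K) : nat -> K := fun m =>
  if m == 0%N then 0 else
  \sum_(P in NC m)
    (\prod_(B in P) f #|B|) * (\prod_(C in kreweras P) g #|C|).

Definition free_cumulants (m kappa : nat -> K) : Prop :=
  forall k, (0 < k)%N -> m k = \sum_(P in NC k) \prod_(B in P) kappa #|B|.

End Series.

From mathcomp Require Import complex all_classical all_reals all_analysis.
Import numFieldNormedType.Exports.

(** * Freeness in a noncommutative probability space [(A, phi)] *)

Section Freeness.
Variables (K : fieldType) (A : algType K) (phi : A -> K).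
Local Open Scope classical_set_scope.

Definition free_family (I : eqType) (F : I -> set A) : Prop :=
  forall (n : nat) (i : nat -> I) (x : nat -> A), (0 < n)%N ->
    (forall k, (k < n)%N -> F (i k) (x k)) ->
    (forall k, (k < n)%N -> phi (x k) = 0) ->
    (forall k, (k.+1 < n)%N -> i k != i k.+1) ->
    phi (\prod_(k < n) x k) = 0.

Definition unital_subalg (a : A) : set A := range (horner_alg a).

Definition free_pair (a b : A) : Prop :=
  free_family (fun i : bool => if i then unital_subalg a else unital_subalg b).

End Freeness.

(** * Probability measures on the real line *)

Section Laws.
Variable R : realType.
Local Open Scope classical_set_scope.
Local Open Scope complex_scope.

Definition compactly_supported (mu : probability (measurableTypeR R) R) :=
  exists2 S : set R, compact S & mu S = 1%E.

Definition moment (mu : probability (measurableTypeR R) R) (k : nat) : R :=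
  \int[mu]_x (x ^+ k).

Definition cmoment (mu : probability (measurableTypeR R) R) (k : nat) : R[i] :=
  (moment mu k)%:C.

Definition is_marchenko_pastur (c : R)
    (mu : probability (measurableTypeR R) R) : Prop :=
  compactly_supported mu /\ free_cumulants (moment mu) (fun k => c ^+ k.-1).

(** [p] is the moment sequence of [mu \boxtimes nu], i.e. of a product of two
    free random variables with distributions [mu] and [nu]. *)
Definition is_free_mul_conv (mu nu : probability (measurableTypeR R) R)
    (p : nat -> R[i]) : Prop :=
  exists (A : algType R[i]) (phi : {scalar A}) (a b : A),
    [/\ phi 1 = 1, free_pair phi a b,
        (forall k, phi (a ^+ k) = cmoment mu k),
        (forall k, phi (b ^+ k) = cmoment nu k) &
        (forall k, phi ((a * b) ^+ k) = p k)].

End Laws.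

(* Main.v *)
Require Import Defs.
From HB Require Import structures.
From mathcomp Require Import all_boot all_order all_algebra.
From mathcomp Require Import zify ring.
Set Implicit Arguments.
Unset Strict Implicit.
Unset Printing Implicit Defensive.
Import GRing.Theory.

(** Let [a], [b] be free with distributions [mu] and [mu_c].  Splitting a
    noncrossing partition at the second element [j] of its first block (the
    points before [j] and the points from [j] on are partitioned independently)
    gives, for the sum [T n k] over partitions of [n + 1] points in which the
    first block counts [k] extra elements,
      [T n k = kappa_(k+1) M n + \sum_(j < n) M j T (n-1-j) (k+1)],
      [M (n+1) = T n 0], [M 0 = 1],
    and this determines the moments [M] from the cumulants [kappa].  For
    [kappa_k = c^(k-1)] it yields the recursion for the moments of [b]; by freeness
    that recursion extends to the Schwinger-Dyson equation
      [phi (x b y) = phi (x y) + c \sum_(y = y' b y'') phi (y' b) phi (x y'')],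
    for [x] a polynomial in [a] and [y] a word in [a], [b].  With
    [x = a^(k+1)] and [y = (a b)^n] this says that
    [T n k = c phi (a^k (a b)^(n+1))] satisfies the above recursion with
    [kappa_k = c phi (a^k)], so [c phi ((a b)^n)] is the [n]-th moment attached to
    the cumulants [c phi (a^k)], which is the claim. *)

(** * Noncrossing partitions of intervals *)

Section IntervalPartitions.
Variable N : nat.
Implicit Types (i j x y : 'I_N) (B C : {set 'I_N}) (P : {set {set 'I_N}}).

Definition itv (lo hi : nat) : {set 'I_N} := [set x : 'I_N | lo <= x < hi].

Definition NC_on (S : {set 'I_N}) : {set {set {set 'I_N}}} :=
  [set P | partition P S & noncrossing P].

Lemma NC_onP (S : {set 'I_N}) P :
  reflect [/\ forall B x, B \in P -> x \in B -> x \in S,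
              forall B, B \in P -> exists x, x \in B,
              forall x, x \in S -> exists2 B, B \in P & x \in B,
              forall B C x, B \in P -> C \in P -> x \in B -> x \in C -> B = C &
              noncrossing P]
          (P \in NC_on S).
Proof.
rewrite inE; apply: (iffP andP) => [[/and3P[/eqP cP tP P0] ncP]|[h1 h2 h3 h4 ncP]].
  split=> //.
  - by move=> B x BP xB; rewrite -cP; apply/bigcupP; exists B.
  - by move=> B BP; apply/set0Pn; apply: contraNneq P0 => <-.
  - by move=> x; rewrite -cP => /bigcupP[B BP xB]; exists B.
  - by move=> B C x BP CP xB xC; rewrite -(def_pblock tP BP xB) (def_pblock tP CP xC).
split=> //; apply/and3P; split.
- apply/eqP/setP => x; apply/bigcupP/idP => [[B BP xB]|/h3[B BP xB]].
    exact: h1 xB.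
  by exists B.
- apply/trivIsetP => B C BP CP; apply: contraR => /pred0Pn[x /andP[xB xC]].
  by apply/eqP; apply: (h4 B C x).
- by apply/negP => /h2[x]; rewrite inE.
Qed.

(** * Splitting a noncrossing partition at the second element of its first block *)

Section Split.
Variables (i : 'I_N) (hi : nat).

(** When [i < j], this says that [j] follows [i] immediately inside a block; [j = i] is not excluded
    here, so [i < j] is assumed separately. *)
Definition next_in (j : 'I_N) P :=
  [exists B in P, [&& i \in B, j \in B & B :&: itv i.+1 j == set0]].

Definition join_block (j : 'I_N) B := if j \in B then i |: B else B.

Definition glue (j : 'I_N) (Q : {set {set 'I_N}} * {set {set 'I_N}}) :=
  Q.1 :|: [set join_block j B | B in Q.2].

(** For a partition with [next_in j P] and [i < j], the blocks in the gap between [i] and [j] form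
    the first part; of the others only the block of [i] changes, and [j] stays in it to mark where
    [i] belongs. *)
Definition unglue (j : 'I_N) P :=
  ([set B in P | B \subset itv i.+1 j],
   [set B :\ i | B in P & ~~ (B \subset itv i.+1 j)]).

Lemma next_inP j P : reflect (exists B, [/\ B \in P, i \in B, j \in B &
    forall x, x \in B -> i < x -> j <= x]) (next_in j P).
Proof.
apply: (iffP exists_inP) => [[B BP /and3P[iB jB /eqP e]]|[B [BP iB jB h]]];
  exists B => //.
  split=> // x xB ix; rewrite leqNgt; apply/negP => xj.
  have: x \in B :&: itv i.+1 j by rewrite !inE xB ix xj.
  by rewrite e inE.
rewrite iB jB /=; apply/eqP/setP => x; rewrite !inE.
by apply/negP => /and3P[xB ix]; rewrite ltnNge h.
Qed.

(** A block with points both inside and outside the gap would cross the block holding [i] and [j],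
    unless it is that block, which has no point in the gap. *)
Lemma unglue_block j P B : i < j -> P \in NC_on (itv i hi) -> next_in j P ->
  B \in P -> ~~ (B \subset itv i.+1 j) ->
  forall x, x \in B -> x = i \/ (j <= x < hi /\ (i \in B -> j \in B)).
Proof.
move=> ij /NC_onP[h1 h2 h3 h4 /noncrossingP nc] /next_inP[B0 [B0P iB0 jB0 hB0]].
move=> BP /subsetPn[y yB yij] x xB.
case: (ltngtP i x) => [ix|xi|/val_inj->]; last by left.
  right; move: (h1 _ _ BP xB) (h1 _ _ BP yB); rewrite !inE => /andP[_ ->] /andP[iy _].
  rewrite andbT; move: yij; rewrite inE negb_and -!leqNgt => yij.
  case: (boolP (i \in B)) => iB.
    have -> : B = B0 by apply: (h4 _ _ i).
    by rewrite jB0; split=> //; apply: hB0 => //; rewrite -(h4 _ _ _ BP B0P iB iB0).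
  split=> //; have iy' : i < y.
    by rewrite ltn_neqAle iy andbT; apply: contraNneq iB => /val_inj->.
  have jy : j <= y by move: yij; rewrite leqNgt iy'.
  rewrite leqNgt; apply/negP => xj.
  have jy' : j < y.
    rewrite ltn_neqAle jy andbT; apply/negP => /eqP/val_inj e.
    by move: iB; rewrite -(h4 _ _ _ B0P BP jB0 _) ?iB0 // e.
  by move: iB; rewrite -(nc B0 B i x j y) ?iB0.
by move: (h1 _ _ BP xB); rewrite inE leqNgt xi.
Qed.

Lemma glueK j P : i < j -> P \in NC_on (itv i hi) -> next_in j P ->
  glue j (unglue j P) = P.
Proof.
move=> ij PN Pj; have ub := unglue_block ij PN Pj.
case/NC_onP: PN => [h1 h2 h3 h4 _]; case/next_inP: Pj => [B0 [B0P iB0 jB0 hB0]].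
have jb B : B \in P -> ~~ (B \subset itv i.+1 j) -> join_block j (B :\ i) = B.
  move=> BP nB; rewrite /join_block !inE (_ : j == i = false); last first.
    by apply: contraTF ij => /eqP->; rewrite ltnn.
  case: ifP => jB.
    by rewrite setD1K // -(h4 _ _ _ B0P BP jB0 jB).
  apply/setDidPl; rewrite disjoint_sym disjoints1; apply/negP => iB.
  by move: jB; rewrite -(h4 _ _ _ B0P BP iB0 iB) jB0.
rewrite /glue /=; apply/setP => B; rewrite inE; apply/orP/idP => [[]|BP].
- by rewrite inE => /andP[].
- case/imsetP=> _ /imsetP[C /[!inE]/andP[CP nC] ->] ->.
  by rewrite jb.
case: (boolP (B \subset itv i.+1 j)) => sB; [left|right].
  by rewrite inE BP.
apply/imsetP; exists (B :\ i); last by rewrite jb.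
by apply/imsetP; exists B; rewrite // inE BP.
Qed.

Lemma unglue_NC j P : i < j -> P \in NC_on (itv i hi) -> next_in j P ->
  ((unglue j P).1 \in NC_on (itv i.+1 j)) /\ ((unglue j P).2 \in NC_on (itv j hi)).
Proof.
move=> ij PN Pj; have ub := unglue_block ij PN Pj.
case/NC_onP: PN => [h1 h2 h3 h4 /noncrossingP nc].
case/next_inP: Pj => [B0 [B0P iB0 jB0 hB0]].
have jhi : j < hi by move: (h1 _ _ B0P jB0); rewrite inE => /andP[].
split; apply/NC_onP; split.
- by move=> B x; rewrite inE => /andP[BP /subsetP sB] /sB.
- by move=> B; rewrite inE => /andP[BP _]; apply: h2.
- move=> x xij; have [|B BP xB] := h3 x.
    by move: xij; rewrite !inE => /andP[/ltnW-> /ltn_trans->].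
  exists B; rewrite // inE BP; apply: contraTT xij => nB.
  case: (ub _ BP nB _ xB) => [->|[/andP[jx _] _]]; rewrite inE ?ltnn //.
  by rewrite [x < j]ltnNge jx andbF.
- by move=> B C x /[!inE] /andP[BP _] /andP[CP _]; apply: h4.
- apply/noncrossingP => B C a b c d /[!inE] /andP[BP _] /andP[CP _].
  exact: nc.
- move=> _ x /imsetP[B /[!inE] /andP[BP nB] ->] /[!inE] /andP[xi xB].
  by case: (ub _ BP nB _ xB) => [xi'|[]//]; rewrite xi' eqxx in xi.
- move=> _ /imsetP[B /[!inE] /andP[BP nB] ->]; case/subsetPn: (nB) => x xB _.
  case: (ub _ BP nB _ xB) => [xi|[/andP[jx _] _]].
    exists j; rewrite !inE neq_ltn ij orbT /=.
    by rewrite -(h4 _ _ _ B0P BP iB0) // -xi.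
  by exists x; rewrite !inE xB andbT neq_ltn (leq_trans ij jx) orbT.
- move=> x; rewrite inE => /andP[jx xhi]; have [|B BP xB] := h3 x.
    by rewrite inE xhi (leq_trans (ltnW ij) jx).
  exists (B :\ i); last by rewrite !inE xB andbT neq_ltn (leq_trans ij jx) orbT.
  apply/imsetP; exists B; rewrite // inE BP; apply/subsetPn; exists x => //.
  by rewrite inE [x < j]ltnNge jx andbF.
- move=> B' C' x /imsetP[B /[!inE] /andP[BP nB] ->] /imsetP[C /[!inE] /andP[CP nC] ->].
  by rewrite !inE => /andP[_ xB] /andP[_ xC]; rewrite (h4 _ _ _ BP CP xB xC).
apply/noncrossingP => B' C' a b c d /imsetP[B /[!inE] /andP[BP nB] ->].
move=> /imsetP[C /[!inE] /andP[CP nC] ->] /[!inE].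
move=> /andP[_ aB] /andP[_ bC] /andP[_ cB] /andP[_ dC] ab bc cd.
by rewrite (nc B C a b c d).
Qed.

Lemma unglueK j Q1 Q2 : i < j -> Q1 \in NC_on (itv i.+1 j) ->
  Q2 \in NC_on (itv j hi) -> unglue j (glue j (Q1, Q2)) = (Q1, Q2).
Proof.
move=> ij /NC_onP[h1 h2 h3 h4 _] /NC_onP[k1 k2 k3 k4 _].
have sQ1 B : B \in Q1 -> B \subset itv i.+1 j.
  by move=> BP; apply/subsetP => x; apply: h1.
have nQ2 B : B \in Q2 -> ~~ (join_block j B \subset itv i.+1 j).
  move=> BQ; have [x xB] := k2 B BQ; apply/subsetPn; exists x.
    by rewrite /join_block; case: ifP => _; rewrite ?inE ?xB ?orbT.
  by have := k1 _ _ BQ xB; rewrite !inE => /andP[jx _]; rewrite [x < j]ltnNge jx andbF.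
have jD B : B \in Q2 -> join_block j B :\ i = B.
  move=> BQ; have iB : i \notin B.
    by apply/negP => /(k1 _ _ BQ); rewrite inE [j <= i]leqNgt ij.
  rewrite /join_block; case: ifP => _; first by rewrite setU1K.
  by apply/setDidPl; rewrite disjoint_sym disjoints1.
rewrite /unglue /glue /=; congr pair; apply/setP => B.
  rewrite !inE; apply/andP/idP => [[/orP[//|/imsetP[C CQ ->]] s]|BQ].
    by move: (nQ2 C CQ); rewrite s.
  by rewrite BQ sQ1.
apply/imsetP/idP => [[C /[!inE] /andP[/orP[CQ|/imsetP[D DQ ->]] n] ->]|BQ].
- by move: n; rewrite sQ1.
- by rewrite jD.
exists (join_block j B); last by rewrite jD.
by rewrite !inE nQ2 // andbT imset_f ?orbT.
Qed.

(** Blocks of [Q1] lie strictly between [i] and [j], and blocks built from [Q2] avoid that gap, so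
    the two kinds cannot cross each other. *)
Lemma glue_NC j Q1 Q2 : i < j < hi -> Q1 \in NC_on (itv i.+1 j) ->
  Q2 \in NC_on (itv j hi) ->
  (glue j (Q1, Q2) \in NC_on (itv i hi)) /\ next_in j (glue j (Q1, Q2)).
Proof.
move=> /andP[ij jhi] /NC_onP[h1 h2 h3 h4 /noncrossingP nc1].
move=> /NC_onP[k1 k2 k3 k4 /noncrossingP nc2].
have in1 B x : B \in Q1 -> x \in B -> i < x < j.
  by move=> BQ /(h1 _ _ BQ); rewrite inE.
have in2 B x : B \in Q2 -> x \in join_block j B ->
    (x = i /\ j \in B) \/ (j <= x < hi /\ x \in B).
  rewrite /join_block => BQ; case: ifP => jB.
    rewrite !inE => /orP[/eqP->|xB]; first by left.
    by right; have := k1 _ _ BQ xB; rewrite inE.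
  by move=> xB; right; have := k1 _ _ BQ xB; rewrite inE.
have ge2 B x : B \in Q2 -> x \in join_block j B -> i <= x.
  by move=> BQ /(in2 _ _ BQ)[[->]|[/andP[/(leq_trans (ltnW ij))]]].
have sub B x : x \in B -> x \in join_block j B.
  by rewrite /join_block; case: ifP => // _ xB; rewrite inE xB orbT.
have mem2 B : B \in Q2 -> join_block j B \in glue j (Q1, Q2).
  by move=> BQ; rewrite inE imset_f ?orbT.
have [B0 B0Q jB0] : exists2 B, B \in Q2 & j \in B by apply: k3; rewrite inE leqnn.
have iB0 : i \in join_block j B0 by rewrite /join_block jB0 !inE eqxx.
split; last first.
  apply/next_inP; exists (join_block j B0).
  split=> //; [exact: mem2|exact: sub|].
  by move=> x /(in2 _ _ B0Q)[[-> _]|[/andP[-> _]]]; rewrite ?ltnn.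
apply/NC_onP; split.
- move=> B x /setUP[BQ /(in1 _ _ BQ)/andP[/ltnW ix xj]|/imsetP[C CQ ->] xC].
    by rewrite inE ix (ltn_trans xj jhi).
  rewrite inE (ge2 _ _ CQ xC); case: (in2 _ _ CQ xC) => [[-> _]|[/andP[_ ->]//]].
  exact: ltn_trans ij jhi.
- move=> B /setUP[/h2//|/imsetP[C CQ ->]].
  by have [x xC] := k2 C CQ; exists x; apply: sub.
- move=> x; rewrite inE => /andP[ix xhi].
  case: (ltnP x j) => xj; last first.
    have [|B BQ xB] := k3 x; first by rewrite inE xj.
    by exists (join_block j B); [apply: mem2|apply: sub].
  case: (ltngtP i x) ix => // [ix _|/val_inj<- _].
    have [|B BQ xB] := h3 x; first by rewrite inE ix.
    by exists B; rewrite // inE BQ.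
  by exists (join_block j B0); first exact: mem2.
- move=> B C x /setUP[BQ|/imsetP[B' BQ ->]] /setUP[CQ|/imsetP[C' CQ ->]].
  + exact: h4.
  + move=> /(in1 _ _ BQ)/andP[ix xj] /(in2 _ _ CQ) [[e _]|[/andP[jx _] _]].
      by rewrite e ltnn in ix.
    by rewrite leqNgt xj in jx.
  + move=> + /(in1 _ _ CQ)/andP[ix xj] => /(in2 _ _ BQ) [[e _]|[/andP[jx _] _]].
      by rewrite e ltnn in ix.
    by rewrite leqNgt xj in jx.
  move=> /(in2 _ _ BQ) [[-> jB]|[jx xB]] /(in2 _ _ CQ) [[e jC]|[jx' xC]].
  + by rewrite (k4 _ _ _ BQ CQ jB jC).
  + by case/andP: jx'; rewrite leqNgt ij.
  + by case/andP: jx; rewrite e leqNgt ij.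
  + by rewrite (k4 _ _ _ BQ CQ xB xC).
apply/noncrossingP.
move=> B C a b c d /setUP[BQ|/imsetP[B' BQ ->]] /setUP[CQ|/imsetP[C' CQ ->]].
- exact: nc1.
- move=> /(in1 _ _ BQ)/andP[ia _] /(in2 _ _ CQ)[[-> _]|[/andP[jb _] _]] /(in1 _ _ BQ)/andP[_ cj] _.
    by rewrite ltnNge (ltnW ia).
  by move=> _ bc; have := leq_ltn_trans jb (ltn_trans bc cj); rewrite ltnn.
- move=> _ /(in1 _ _ CQ)/andP[ib _] /(in2 _ _ BQ)[[-> _]|[/andP[jc _] _]] /(in1 _ _ CQ)/andP[_ dj] _.
    by rewrite ltnNge (ltnW ib).
  by move=> _ cd; have := leq_ltn_trans jc (ltn_trans cd dj); rewrite ltnn.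
move=> aB bC cB dC ab bc cd; have ib := leq_ltn_trans (ge2 _ _ BQ aB) ab.
have ic := ltn_trans ib bc; have id := ltn_trans ic cd.
case: (in2 _ _ CQ bC) => [[eb _]|[/andP[jb _] {}bC]]; first by rewrite eb ltnn in ib.
case: (in2 _ _ BQ cB) => [[ec _]|[_ {}cB]]; first by rewrite ec ltnn in ic.
case: (in2 _ _ CQ dC) => [[ed _]|[_ {}dC]]; first by rewrite ed ltnn in id.
(* Since [i] is least, only [a] can be the added point; replacing it by [j], which lies in the same
   block, moves the crossing into [Q2], or makes the two blocks share [j = b]. *)
case: (in2 _ _ BQ aB) => [[ea jB]|[_ {}aB]]; last by rewrite (nc2 B' C' a b c d).
case: (ltngtP j b) jb => // [jb _|/val_inj e _].
  by rewrite (nc2 B' C' j b c d).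
by rewrite (k4 B' C' j) // e.
Qed.

End Split.

(** * Weighted sums over noncrossing partitions of an interval *)

Section Sums.
Variable K : comNzRingType.
Local Open Scope ring_scope.
Implicit Types (g : {set 'I_N} -> K) (hi lo : nat).

Definition NC_sum g (S : {set 'I_N}) : K := \sum_(P in NC_on S) \prod_(B in P) g B.

Lemma NC_sum_set0 g : NC_sum g set0 = 1.
Proof.
rewrite /NC_sum (big_pred1 set0) ?big_set0 // => P.
apply/NC_onP/eqP => [[h1 h2 _ _ _]|->].
  by apply/setP => B; rewrite inE; apply/negP => BP; have [x /h1] := h2 _ BP; rewrite inE => /(_ BP).
by split=> [B x|B|x|B C x|]; rewrite ?inE //; apply/noncrossingP => B C a b c d; rewrite inE.
Qed.

Lemma eq_NC_sum g g' (S : {set 'I_N}) :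
  (forall B, B \subset S -> g B = g' B) -> NC_sum g S = NC_sum g' S.
Proof.
move=> e; apply: eq_bigr => P /NC_onP[h1 _ _ _ _]; apply: eq_bigr => B BP.
by apply: e; apply/subsetP => x; apply: h1.
Qed.

Section SumSplit.
Variables (i : 'I_N) (hi : nat).
Hypothesis i_hi : (i < hi)%N.

(** Deleting the block [[set i]] is a bijection onto the partitions of the remaining points; putting
    it back is harmless, as a singleton crosses nothing. *)
Lemma NC_sum_singleton g :
  \sum_(P in NC_on (itv i hi) | [set i] \in P) \prod_(B in P) g B =
  g [set i] * NC_sum g (itv i.+1 hi).
Proof.
rewrite /NC_sum big_distrr /=.
rewrite (reindex_onto (fun P => [set i] |: P) (fun P => P :\ [set i])) /=; last first.
  by move=> P /andP[_ iP]; rewrite setD1K.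
have ni P : P \in NC_on (itv i.+1 hi) -> [set i] \notin P.
  by move=> /NC_onP[h1 _ _ _ _]; apply/negP => /h1/(_ (set11 i)); rewrite inE ltnn.
apply: eq_big => [P|P /andP[/andP[_ _] /eqP e]]; last first.
  by rewrite big_setU1 // -e !inE eqxx.
rewrite setU11 andbT; apply/andP/idP => [[/NC_onP[h1 h2 h3 h4 /noncrossingP nc] /eqP e]|PN].
  have iP : [set i] \notin P by rewrite -e !inE eqxx.
  have UP B : B \in P -> B \in [set i] |: P by move=> BP; rewrite inE BP orbT.
  have inB B : B \in P -> i \notin B.
    move=> BP; apply/negP => iB; move: iP.
    by rewrite (h4 [set i] B i) ?BP ?set11 ?setU11 ?UP.
  apply/NC_onP; split.
  - move=> B x BP xB; move: (h1 _ _ (UP _ BP) xB); rewrite !inE => /andP[ix ->].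
    rewrite andbT ltn_neqAle ix andbT; apply: contraTneq xB => e'.
    by rewrite -(val_inj e') inB.
  - by move=> B /UP; apply: h2.
  - move=> x; rewrite inE => /andP[ix xhi]; have [|B] := h3 x; first by rewrite inE xhi ltnW.
    by move=> /setU1P[->|BP]; [rewrite inE => /eqP e'; rewrite e' ltnn in ix|exists B].
  - by move=> B C x /UP BP /UP CP; apply: h4.
  - by apply/noncrossingP => B C a b c d /UP BP /UP CP; apply: nc.
rewrite setU1K ?ni //; split=> //; case/NC_onP: PN => h1 h2 h3 h4 /noncrossingP nc.
have h1' B x : B \in P -> x \in B -> (i < x < hi)%N by move=> BP /(h1 _ _ BP); rewrite inE.
apply/NC_onP; split.
- move=> B x /setU1P[->|BP] => [/set1P->|/(h1' _ _ BP)/andP[/ltnW]]; rewrite inE ?leqnn //.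
  by move=> -> ->.
- by move=> B /setU1P[->|/h2//]; exists i; rewrite inE.
- move=> x; rewrite inE => /andP[]; rewrite leq_eqVlt => /predU1P[/val_inj<- _|ix xhi].
    by exists [set i]; rewrite ?inE ?eqxx.
  by have [|B BP xB] := h3 x; [rewrite inE ix|exists B; rewrite // inE BP orbT].
- move=> B C x /setU1P[->|BP] /setU1P[->|CP] //.
  + by move=> /set1P-> /(h1' _ _ CP); rewrite ltnn.
  + by move=> + /set1P e; rewrite e => /(h1' _ _ BP); rewrite ltnn.
  exact: h4.
apply/noncrossingP => B C a b c d /setU1P[->|BP] /setU1P[->|CP] //.
- by move=> /set1P-> _ /set1P->; lia.
- by move=> _ /set1P-> _ /set1P->; lia.
exact: nc.
Qed.

(** Summation along the bijection [glue]; the weight in the second factor charges the block of [j]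
    as if [i] had been put back. *)
Lemma NC_sum_next g (j : 'I_N) : (i < j < hi)%N ->
  \sum_(P in NC_on (itv i hi) | next_in i j P) \prod_(B in P) g B =
  NC_sum g (itv i.+1 j) * NC_sum (g \o join_block i j) (itv j hi).
Proof.
move=> ijhi; have /andP[ij jhi] := ijhi.
rewrite /NC_sum big_distrlr pair_big /=.
rewrite (reindex_onto (glue i j) (unglue i j)) /=; last first.
  by move=> P /andP[PN Pj]; apply: glueK PN Pj.
apply: eq_big => [[Q1 Q2]|[Q1 Q2] /andP[/andP[PN Pj] /eqP e]] /=.
  apply/andP/andP => [[/andP[PN Pj] /eqP e]|[N1 N2]].
    by have := unglue_NC ij PN Pj; rewrite e.
  by rewrite (unglueK ij N1 N2) eqxx; have [-> ->] := glue_NC ijhi N1 N2.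
have := unglue_NC ij PN Pj; rewrite e /= => -[/NC_onP[h1 h2 _ _ _] /NC_onP[k1 k2 _ _ _]].
have ijB B x : x \in B -> x \in join_block i j B.
  by rewrite /join_block; case: ifP => // _ xB; rewrite inE xB orbT.
rewrite /glue /= (eq_bigl [in [predU Q1 & [set join_block i j B | B in Q2]]]); last first.
  by move=> B; rewrite !inE.
rewrite bigU /=; first congr (_ * _); last first.
  apply/pred0P => B /=; apply/negP => /andP[BQ].
  case/imsetP=> C CQ eB; have [x xC] := k2 _ CQ.
  have := h1 _ _ BQ; rewrite eB => /(_ x); rewrite ijB // inE => /(_ isT).
  by have := k1 _ _ CQ xC; rewrite !inE; lia.
rewrite big_imset //= => B C BQ CQ eBC.
have jK D : D \in Q2 -> join_block i j D :\ i = D.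
  move=> DQ; have iD : i \notin D.
    by apply/negP => /(k1 _ _ DQ); rewrite inE; lia.
  rewrite /join_block; case: ifP => _; first by rewrite setU1K.
  by apply/setDidPl; rewrite disjoint_sym disjoints1.
by rewrite -(jK _ BQ) eBC jK.
Qed.

(** The default [i] encodes a singleton first block, so that one function into ['I_N] indexes every
    case of the recursion. *)
Definition next_elt (P : {set {set 'I_N}}) : 'I_N :=
  odflt i [pick j : 'I_N | (i < j)%N && next_in i j P].

Lemma next_inj P (j j' : 'I_N) : P \in NC_on (itv i hi) -> (i < j)%N -> (i < j')%N ->
  next_in i j P -> next_in i j' P -> j = j'.
Proof.
move=> /NC_onP[_ _ _ h4 _] ij ij' /next_inP[B [BP iB jB hB]] /next_inP[C [CP iC jC hC]].
have e := h4 _ _ _ BP CP iB iC; subst C.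
by apply/val_inj/eqP; rewrite eqn_leq hB ?hC.
Qed.

Lemma next_elt_singleton P : P \in NC_on (itv i hi) ->
  (next_elt P == i) = ([set i] \in P).
Proof.
move=> PN; have /NC_onP[h1 _ h3 h4 _] := PN.
rewrite /next_elt; case: pickP => [j /andP[ij /next_inP[B [BP iB jB _]]]|n] /=.
  rewrite [LHS]eq_sym [LHS]ltn_eqF //; apply/esym/negP => iP.
  move: jB; rewrite (h4 B [set i] i) ?set11 // inE => /eqP e.
  by rewrite e ltnn in ij.
rewrite eqxx; apply/esym; have [|B BP iB] := h3 i; first by rewrite inE leqnn.
suff -> : [set i] = B by [].
apply/setP => x; rewrite inE; apply/eqP/idP => [->//|xB].
apply/eqP; case: eqP => // /eqP xi.
(* If [i] had company in its block, the least other element would satisfy [next_in]. *)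
have [j /andP[/= jB ji] jmin] :=
  @arg_minnP _ x [pred y | (y \in B) && (y != i)] (fun y : 'I_N => nat_of_ord y)
    (introT andP (conj xB xi)).
have gt y : y \in B -> y != i -> (i < y)%N.
  move=> yB yi; have := h1 _ _ BP yB; rewrite inE => /andP[iy _].
  by rewrite ltn_neqAle iy andbT eq_sym.
have := n j; rewrite gt //= => /negbT/negP[]; apply/next_inP; exists B; split=> // y yB iy.
by apply: jmin; rewrite /= yB neq_ltn iy orbT.
Qed.

Lemma next_elt_next P (j : 'I_N) : P \in NC_on (itv i hi) -> (i < j)%N ->
  (next_elt P == j) = next_in i j P.
Proof.
move=> PN ij; rewrite /next_elt; case: pickP => [k /andP[ik kP]|n] /=.
  apply/eqP/idP => [<-//|jP]; exact: (next_inj PN).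
have := n j; rewrite ij /= => ->.
by apply: contraTF ij => /eqP->; rewrite ltnn.
Qed.

(** The partitions are sorted by [next_elt]: the value [i] gives the first summand, each value [j]
    beyond [i] one term of the sum. *)
Lemma NC_sum_rec g : NC_sum g (itv i hi) =
  g [set i] * NC_sum g (itv i.+1 hi) +
  \sum_(j : 'I_N | (i < j < hi)%N)
    NC_sum g (itv i.+1 j) * NC_sum (g \o join_block i j) (itv j hi).
Proof.
rewrite {1}/NC_sum (partition_big next_elt (fun j : 'I_N => i <= j < hi)%N) /=; last first.
  move=> P /NC_onP[h1 _ _ _ _]; rewrite /next_elt; case: pickP => [j|] /=; last by rewrite leqnn.
  move=> /andP[ij /next_inP[B [BP _ jB _]]]; have := h1 _ _ BP jB.
  by rewrite inE.
rewrite (bigD1 i) ?leqnn //=; congr (_ + _).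
  rewrite -NC_sum_singleton; apply: eq_bigl => P.
  by case: (boolP (P \in _)) => // PN; rewrite next_elt_singleton.
apply: eq_big => [j|j /andP[/andP[ij jhi] ji]].
  by rewrite andbAC [(i < j)%N]ltn_neqAle -val_eqE /= eq_sym [(_ != _) && _]andbC.
have ij' : (i < j)%N by rewrite ltn_neqAle ij andbT eq_sym.
rewrite -NC_sum_next ?ij' //; apply: eq_bigl => P.
by case: (boolP (P \in _)) => // PN; rewrite next_elt_next.
Qed.

End SumSplit.
End Sums.
End IntervalPartitions.

Arguments itv {N}.

(** * The recursion for free cumulants *)

Section CumulantSums.
Variables (K : comNzRingType) (kappa : nat -> K).
Local Open Scope ring_scope.

(** Here [lo] is a natural number and not an ordinal, so that the empty interval starting at [N] is
    allowed. *)
Definition bump_weight N (lo k : nat) (B : {set 'I_N}) : K :=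
  kappa (#|B| + if [exists x in B, x == lo :> nat] then k else 0).

(** The extra [k] stands for points, to the left of [lo], already put into the
    block of [lo]. *)
Definition NC_itv N lo hi k : K := NC_sum (bump_weight lo k) (@itv N lo hi).

Definition cumulant_sum n : K := \sum_(P in NC n) \prod_(B in P) kappa #|B|.

Definition first_block_sum n k : K := NC_itv n.+1 0 n.+1 k.

Lemma itv_geq N lo hi : (hi <= lo)%N -> @itv N lo hi = set0.
Proof.
by move=> h; apply/setP => x; rewrite !inE; apply/negP => /andP[a b]; have := leq_trans b (leq_trans h a); rewrite ltnn.
Qed.

Lemma NC_itv_bump0 N lo lo' hi k : (lo' < lo)%N ->
  NC_sum (bump_weight lo' k) (@itv N lo hi) = NC_itv N lo hi 0.
Proof.
move=> h; apply: eq_NC_sum => B /subsetP sB; rewrite /bump_weight; congr kappa.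
case: exists_inP => [[x /sB]|_]; last by case: ifP.
by rewrite inE => /andP[lox _] /eqP e; move: h; rewrite -e ltnNge lox.
Qed.

(** Joining [lo] to the block of the second element, here [j + lo.+1], adds one point to it, so a
    bump of [k] at [lo] becomes a bump of [k.+1] there. *)
Lemma NC_itv_rec N lo hi k : (lo < hi <= N)%N ->
  NC_itv N lo hi k = kappa k.+1 * NC_itv N lo.+1 hi 0 +
    \sum_(0 <= j < hi - lo.+1)
       NC_itv N lo.+1 (j + lo.+1) 0 * NC_itv N (j + lo.+1) hi k.+1.
Proof.
case/andP=> lohi hiN; have loN := leq_trans lohi hiN.
pose i := Ordinal loN; rewrite /NC_itv (@NC_sum_rec N K i hi lohi) /=; congr (_ * _ + _).
- rewrite /bump_weight cards1; case: exists_inP => // -[].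
  by exists i; rewrite ?inE.
- exact: NC_itv_bump0.
rewrite -(big_addn 0 hi lo.+1 xpredT (fun j => NC_sum (bump_weight lo.+1 0) (@itv N lo.+1 j) *
  NC_sum (bump_weight j k.+1) (@itv N j hi))) add0n.
rewrite (big_nat_widen _ _ _ _ _ hiN) big_geq_mkord.
apply: eq_big => [j|j /andP[ij _]]; first by rewrite andbC.
congr (_ * _); first exact: NC_itv_bump0.
apply: eq_NC_sum => B /subsetP sB; rewrite /bump_weight /join_block /=.
have iB : i \notin B by apply/negP => /sB; rewrite inE leqNgt ij.
have jB : [exists x in B, x == j :> nat] = (j \in B).
  by apply/exists_inP/idP => [[x xB /eqP/val_inj<-]|]; last by exists j.
have iN : [exists x in B, x == lo :> nat] = false.
  apply/exists_inP => -[x xB /eqP e].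
  by move: iB; rewrite (_ : i = x) ?xB //; apply: val_inj.
rewrite jB; case: ifP => _; last by rewrite iN.
rewrite cardsU1 iB; case: exists_inP => [_|[]]; last by exists i; rewrite ?setU11 /=.
by rewrite add1n addSnnS.
Qed.

Lemma NC_itv_nil N lo k : NC_itv N lo lo k = 1.
Proof. by rewrite /NC_itv itv_geq // NC_sum_set0. Qed.

(** No partition is translated: by [NC_itv_rec] both sides obey one recursion, which sees only
    lengths, and strong induction on [d] concludes. *)
Lemma NC_itv_shift d N N' lo lo' k : (lo + d <= N)%N -> (lo' + d <= N')%N ->
  NC_itv N lo (lo + d) k = NC_itv N' lo' (lo' + d) k.
Proof.
elim/ltn_ind: d N N' lo lo' k => -[|d] IH N N' lo lo' k h h'.
  by rewrite !addn0 !NC_itv_nil.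
rewrite [LHS]NC_itv_rec; last by lia.
rewrite [RHS]NC_itv_rec; last by lia.
rewrite !addnS -!addSn !addKn.
congr (_ + _).
  by congr (_ * _); apply: IH => //; rewrite addSnnS.
apply: eq_big_nat => j /= jd; rewrite ![(j + _)%N]addnC; congr (_ * _).
  by apply: IH; lia.
have -> : (lo.+1 + d = lo.+1 + j + (d - j))%N by lia.
have -> : (lo'.+1 + d = lo'.+1 + j + (d - j))%N by lia.
by apply: IH; lia.
Qed.

Lemma NC_itv_cumulant_sum N lo d : (lo + d <= N)%N -> NC_itv N lo (lo + d) 0 = cumulant_sum d.
Proof.
move=> h; rewrite (@NC_itv_shift d N d lo 0 0) //.
rewrite /NC_itv /NC_sum /cumulant_sum (_ : NC_on _ = NC d); last first.
  by apply/setP => P; rewrite !inE; congr (partition P _ && _); apply/setP => x; rewrite !inE ltn_ord.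
by apply: eq_bigr => P _; apply: eq_bigr => B _; rewrite /bump_weight if_same addn0.
Qed.

Lemma cumulant_sum0 : cumulant_sum 0 = 1.
Proof. by rewrite -(@NC_itv_cumulant_sum 0 0) // NC_itv_nil. Qed.

Lemma cumulant_sumS n : cumulant_sum n.+1 = first_block_sum n 0.
Proof. by rewrite -(@NC_itv_cumulant_sum n.+1 0). Qed.

Lemma first_block_sum_rec n k : first_block_sum n k =
  kappa k.+1 * cumulant_sum n +
  \sum_(j < n) cumulant_sum j * first_block_sum (n - j.+1) k.+1.
Proof.
rewrite /first_block_sum NC_itv_rec ?leqnn //; congr (_ * _ + _).
  exact: (@NC_itv_cumulant_sum n.+1 1).
rewrite subSS subn0 big_mkord; apply: eq_bigr => j _; rewrite addnC.
have jn := ltn_ord j; congr (_ * _).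
  by rewrite -(@NC_itv_cumulant_sum n.+1 1) //; lia.
have := @NC_itv_shift (n - j.+1).+1 n.+1 (n - j.+1).+1 (0 + j.+1) 0 k.+1.
rewrite (_ : (0 + j.+1 + (n - j.+1).+1 = n.+1)%N); last by lia.
by rewrite !add0n => -> //; lia.
Qed.

(** The recursion for [T n k] raises [k] but lowers [n], so induction on [n], for all [k] at once,
    determines [M] and [T] together. *)
Lemma cumulant_sum_unique (M : nat -> K) (T : nat -> nat -> K) :
  M 0%N = 1 -> (forall n, M n.+1 = T n 0%N) ->
  (forall n k, T n k = kappa k.+1 * M n + \sum_(j < n) M j * T (n - j.+1)%N k.+1) ->
  forall n, cumulant_sum n = M n.
Proof.
move=> M0 MS TR.
suff H n : (forall j, (j <= n)%N -> cumulant_sum j = M j) /\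
           (forall j k, (j < n)%N -> first_block_sum j k = T j k).
  by move=> n; apply: (H n).1.
elim: n => [|n [IHM IHT]].
  by split=> // -[|//] _; rewrite cumulant_sum0.
have e k : first_block_sum n k = T n k.
  rewrite first_block_sum_rec TR IHM //; congr (_ + _); apply: eq_bigr => j _.
  by have jn := ltn_ord j; rewrite IHM ?IHT //; lia.
split=> [j|j k]; rewrite ?ltnS leq_eqVlt => /predU1P[->|jn] //.
- by rewrite cumulant_sumS e MS.
- exact: IHM.
exact: IHT.
Qed.

End CumulantSums.

Lemma geometric_cumulant_sum_rec (K : comNzRingType) (c : K) n :
  let M := cumulant_sum (fun k => (c ^+ k.-1)%R) in
  (M n.+1 = M n + c * \sum_(j < n) M j * M (n - j)%N)%R.
Proof.
move=> M; rewrite [LHS]cumulant_sumS first_block_sum_rec expr0 mul1r big_distrr /=.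
(* For geometric cumulants each extra element of the first block contributes a factor [c], which
   closes the recursion on [M] alone. *)
suff e m k : (first_block_sum (fun k => (c ^+ k.-1)%R) m k = c ^+ k * M m.+1)%R.
  congr (_ + _)%R; apply: eq_bigr => j _.
  by rewrite e expr1 mulrCA subnSK.
elim/ltn_ind: m k => m IH k; rewrite /M cumulant_sumS [LHS]first_block_sum_rec.
rewrite [first_block_sum _ _ 0]first_block_sum_rec mulrDr expr0 mul1r.
congr (_ + _)%R; rewrite big_distrr /=; apply: eq_bigr => j _; rewrite !IH; try by have := ltn_ord j; lia.
by rewrite exprSr; ring.
Qed.

Local Open Scope ring_scope.

(** * Products of free elements *)

Section PolyAction.
Variables (K : comNzRingType) (V : lmodType K) (T : {linear V -> V}).
Implicit Types (p q : {poly K}) (v : V).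

Definition poly_act p v : V := \sum_(i < size p) p`_i *: iter i T v.

Lemma poly_act_widen n p v : (size p <= n)%N ->
  poly_act p v = \sum_(i < n) p`_i *: iter i T v.
Proof.
move=> h; rewrite /poly_act (big_ord_widen _ (fun i => p`_i *: iter i T v) h) big_mkcond.
by apply: eq_bigr => i _; case: ltnP => // pi; rewrite nth_default // scale0r.
Qed.

Lemma poly_actB p q v : poly_act (p - q) v = poly_act p v - poly_act q v.
Proof.
pose n := maxn (size p) (size q).
rewrite !(@poly_act_widen n) ?leq_maxl ?leq_maxr //; last first.
  by rewrite (leq_trans (size_polyD _ _)) // size_polyN.
by rewrite -sumrB; apply: eq_bigr => i _; rewrite coefB scalerBl.
Qed.

Lemma poly_actC k v : poly_act k%:P v = k *: v.
Proof.
by rewrite (@poly_act_widen 1) ?size_polyC_leq1 // big_ord1 coefC.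
Qed.

Lemma poly_actXM p v : poly_act ('X * p) v = T (poly_act p v).
Proof.
rewrite (@poly_act_widen (size p).+1); last first.
  by rewrite (leq_trans (size_polyMleq _ _)) // size_polyX.
rewrite big_ord_recl coefXM eqxx scale0r add0r linear_sum.
by apply: eq_bigr => i _; rewrite linearZ_LR coefXM /=.
Qed.

Lemma poly_actX v : poly_act 'X v = T v.
Proof. by rewrite -['X]mulr1 poly_actXM (poly_actC 1) scale1r. Qed.

End PolyAction.

(** * Alternating centered words in two free elements *)

Section FreePair.
Variables (K : fieldType) (A : algType K) (phi : {scalar A}) (a b : A).
Hypotheses (phi1 : phi 1 = 1) (ab_free : free_pair phi a b).

Definition letter (l : bool * {poly K}) : A := horner_alg (if l.1 then a else b) l.2.

Lemma letter_sum t p : letter (t, p) = \sum_(i < size p) p`_i *: (if t then a else b) ^+ i.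
Proof.
rewrite /letter /= -{1}[p]coefK poly_def linear_sum; apply: eq_bigr => i _.
by rewrite linearZ /= mulr_algl rmorphXn /= horner_algX.
Qed.

Definition alternating (w : seq (bool * {poly K})) := sorted (fun l l' => l.1 != l'.1) w.

Lemma alternating_head t p q w : alternating ((t, p) :: w) = alternating ((t, q) :: w).
Proof. by case: w. Qed.

Definition centered (w : seq (bool * {poly K})) := all (fun l => phi (letter l) == 0) w.

Definition center (t : bool) (p : {poly K}) : {poly K} := p - (phi (letter (t, p)))%:P.

Lemma letter_center t p : letter (t, center t p) = letter (t, p) - (phi (letter (t, p)))%:A.
Proof. by rewrite /letter /center /= rmorphB /= horner_algC. Qed.

Lemma phi_scalar k : phi k%:A = k.
Proof. by rewrite linearZ /= phi1 mulr1. Qed.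

Lemma phi_center t p : phi (letter (t, center t p)) == 0.
Proof. by rewrite letter_center linearB /= phi_scalar subrr. Qed.

Lemma phi_alternating w : w != [::] -> alternating w -> centered w ->
  phi (\prod_(l <- w) letter l) = 0.
Proof.
move=> w0 aw /allP cw; pose l0 : bool * {poly K} := (true, 0).
rewrite (big_nth l0) big_mkord.
apply: (ab_free (n := size w) (i := fun k => (nth l0 w k).1)
  (x := fun k => letter (nth l0 w k))).
- by rewrite lt0n size_eq0.
- by move=> k kw; rewrite /letter; case: ifP => _; exists (nth l0 w k).2.
- by move=> k kw; apply/eqP/cw/mem_nth.
by move=> k kw; move/(sortedP l0): aw => /(_ _ kw).
Qed.

(** Splitting the last letter into a centered part and a scalar leaves two nonempty alternating
    centered words, the shorter being [w]. *)
Lemma phi_alternating_letter w t q : w != [::] -> alternating (rcons w (t, q)) ->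
  centered w -> phi (\prod_(l <- w) letter l * letter (t, q)) = 0.
Proof.
move=> w0 aw cw; have aw0 : alternating w.
  by move: aw; rewrite /alternating -cats1 => /cat_sorted2[].
have e : letter (t, q) = letter (t, center t q) + (phi (letter (t, q)))%:A.
  by rewrite letter_center subrK.
rewrite e mulrDr linearD /= -scalerAr mulr1 linearZ /= (phi_alternating w0) // mulr0 addr0.
rewrite (_ : _ * _ = \prod_(l <- rcons w (t, center t q)) letter l).
  apply: phi_alternating => //; first by case: (w).
    case: w {cw w0 e aw0} aw => [|l w] //=.
    by rewrite !rcons_path.
  by rewrite /centered all_rcons phi_center.
by rewrite -cats1 big_cat big_seq1.
Qed.

(** * The Schwinger-Dyson equation with a fixed left factor [x] *)

Section LeftFactor.
Variables (px : {poly K}).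
Let x := letter (true, px).

Lemma phi_left_alternating q w : alternating ((false, q) :: w) -> centered ((false, q) :: w) ->
  phi (x * \prod_(l <- (false, q) :: w) letter l) = 0.
Proof.
move=> aw cw; have e : x = letter (true, center true px) + (phi x)%:A.
  by rewrite letter_center subrK.
rewrite e mulrDl linearD /= -scalerAl mul1r linearZ /= phi_alternating // mulr0 addr0.
rewrite -(big_cons _ _ (true, center true px) _ xpredT) /=.
by apply: phi_alternating => //; rewrite /centered /= phi_center.
Qed.

(** The centered part of the first letter contributes nothing by [phi_left_alternating], so only its
    scalar part remains. *)
Lemma phi_left_letter q w : alternating ((false, q) :: w) -> centered w ->
  phi (x * (letter (false, q) * \prod_(l <- w) letter l)) =
  phi (letter (false, q)) * phi (x * \prod_(l <- w) letter l).
Proof.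
move=> aw cw.
have {1}-> : letter (false, q) = letter (false, center false q) + (phi (letter (false, q)))%:A.
  by rewrite letter_center subrK.
rewrite mulrDl mulrDr linearD /= -!scalerAl mul1r -scalerAr linearZ /=.
rewrite -(big_cons _ _ (false, center false q) _ xpredT) /=.
rewrite phi_left_alternating ?add0r //.
  by rewrite (alternating_head _ _ q).
by apply/andP; split; first exact: phi_center.
Qed.

(** The second component records the splittings of a word:
    acting by the word [y] on [(1, 0)] gives
    [(y, \sum_(y = y' b y'') phi (x y'') *: y' b)]. *)
Definition hat (t : bool) (v : A * A) : A * A :=
  if t then (a * v.1, a * v.2) else (b * v.1, b * v.2 + phi (x * v.1) *: b).

Lemma hat_is_linear t : linear (hat t).
Proof.
case: t => k [u1 u2] [v1 v2]; rewrite /hat /=; congr pair.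
- by rewrite mulrDr -scalerAr.
- by rewrite mulrDr -scalerAr.
- by rewrite mulrDr -scalerAr.
rewrite !mulrDr linearD /= -!scalerAr linearZ /= scalerDl scalerDr scalerA.
by rewrite addrACA.
Qed.

HB.instance Definition _ t :=
  GRing.isLinear.Build K (A * A)%type (A * A)%type _ (hat t) (hat_is_linear t).

Definition word_act (w : seq (bool * {poly K})) : A * A :=
  foldr (fun l => poly_act (hat l.1) l.2) (1, 0) w.

(** Both sides of the Schwinger-Dyson equation are linear in the pair, so it suffices to check these
    generators; [hat] preserves the span, which therefore contains the pair of every word in [a] and
    [b]. *)
Inductive alternating_span : A * A -> Prop :=
| alternating_span_word w : alternating w -> centered w -> alternating_span (word_act w)
| alternating_span_lin k u v : alternating_span u -> alternating_span v ->
    alternating_span (k *: u + v).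

(** A new letter is prepended as ['X] or merges with the first letter as ['X * p]; centering it
    costs a scalar multiple of the tail. *)
Lemma alternating_span_hat t v : alternating_span v -> alternating_span (hat t v).
Proof.
elim=> [w aw cw|k u {}v _ IHu _ IHv]; last first.
  by rewrite hat_is_linear; apply: alternating_span_lin.
have step p w' : alternating ((t, p) :: w') -> centered w' ->
    alternating_span (poly_act (hat t) p (word_act w')).
  move=> aw' cw'; pose k := phi (letter (t, p)).
  have -> : poly_act (hat t) p (word_act w') =
      k *: word_act w' + poly_act (hat t) (center t p) (word_act w').
    by rewrite poly_actB poly_actC addrC subrK.
  apply: alternating_span_lin; first by apply: alternating_span_word => //; apply: path_sorted aw'.
  rewrite -[poly_act _ _ _]/(word_act ((t, center t p) :: w')).
  apply: alternating_span_word; first by rewrite (alternating_head _ _ p).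
  by apply/andP; split; first exact: phi_center.
case: w aw cw => [|[t' p] w] aw cw; first by rewrite -poly_actX; apply: step.
case: (eqVneq t t') => [tt'|tt']; last first.
  by rewrite -poly_actX; apply: step => //; rewrite /alternating /= tt'.
subst t'; rewrite /= -poly_actXM; apply: step; first by rewrite (alternating_head _ _ p).
by case/andP: cw.
Qed.

Lemma fst_poly_act t p v : (poly_act (hat t) p v).1 = letter (t, p) * v.1.
Proof.
have it n : (iter n (hat t) v).1 = (if t then a else b) ^+ n * v.1.
  elim: n => [|n IH]; first by rewrite mul1r.
  by rewrite iterS exprS -mulrA -IH; case: (t).
rewrite letter_sum mulr_suml /poly_act (raddf_sum (@fst A A)).
by apply: eq_bigr => i _; rewrite /= it scalerAl.
Qed.

Lemma fst_word_act w : (word_act w).1 = \prod_(l <- w) letter l.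
Proof.
elim: w => [|[t p] w IH]; first by rewrite big_nil.
by rewrite big_cons -IH -fst_poly_act.
Qed.

Lemma snd_poly_act_a p v : (poly_act (hat true) p v).2 = letter (true, p) * v.2.
Proof.
have it n : (iter n (hat true) v).2 = a ^+ n * v.2.
  by elim: n => [|n IH]; rewrite ?mul1r // iterS exprS -mulrA -IH.
rewrite letter_sum mulr_suml /poly_act (raddf_sum (@snd A A)).
by apply: eq_bigr => i _; rewrite /= it scalerAl.
Qed.

(** The free difference quotient of [p], with one more factor ['X] on its left leg, and with
    [phi (x * (_ * y))] applied to its right leg. It is kept as a polynomial so that its value at
    [b] is again a letter. *)
Definition diff_poly p (y : A) : {poly K} :=
  \sum_(i < size p) p`_i *: \sum_(j < i) phi (x * (b ^+ j * y)) *: 'X^(i - j).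

Lemma snd_poly_act_b p v : (poly_act (hat false) p v).2 =
  letter (false, p) * v.2 + letter (false, diff_poly p v.1).
Proof.
have it n : iter n (hat false) v =
   (b ^+ n * v.1, b ^+ n * v.2 + \sum_(j < n) phi (x * (b ^+ j * v.1)) *: b ^+ (n - j)).
  elim: n => [|n IH]; first by rewrite big_ord0 addr0 !mul1r; case: v.
  rewrite iterS IH /hat /= exprS mulrA; congr pair; rewrite mulrDr mulrA -addrA big_ord_recr /=.
  congr (_ + (_ + _)); last by rewrite subSnn expr1.
  rewrite mulr_sumr; apply: eq_bigr => j _.
  by rewrite subSn ?exprS ?scalerAr // ltnW.
rewrite (letter_sum false p) mulr_suml /poly_act (raddf_sum (@snd A A)) /diff_poly.
rewrite /letter /= linear_sum -big_split; apply: eq_bigr => i _ /=.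
rewrite it /= scalerDr scalerAl; congr (_ + _).
rewrite linearZ /= mulr_algl; congr (_ *: _); rewrite linear_sum; apply: eq_bigr => j _.
by rewrite linearZ /= mulr_algl rmorphXn /= horner_algX.
Qed.

(** The second component is built from pieces ending in a letter in [b]; behind [u] each becomes an
    alternating word whose letters, except possibly the last, are centered, and [phi] kills it. *)
Lemma phi_prefix_snd w u : u != [::] -> alternating (u ++ w) -> centered (u ++ w) ->
  phi (\prod_(l <- u) letter l * (word_act w).2) = 0.
Proof.
elim: w u => [|[t p] w IH] u u0; first by rewrite mulr0 raddf0.
rewrite -cat_rcons => auw cuw.
have IHu : phi (\prod_(l <- u) letter l * (letter (t, p) * (word_act w).2)) = 0.
  rewrite mulrA -[RHS](IH (rcons u (t, p))) //; last by case: (u).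
  by rewrite -cats1 big_cat big_seq1.
case: t IHu auw cuw => IHu auw cuw.
  by rewrite -[RHS]IHu -snd_poly_act_a.
rewrite [(word_act _).2]snd_poly_act_b mulrDr linearD /= IHu add0r.
apply: phi_alternating_letter => //; last first.
  by move: cuw; rewrite /centered -cats1 -catA all_cat => /andP[].
move: auw; rewrite cat_rcons -cat1s catA => /cat_sorted2[+ _]; rewrite cats1.
by case: (u) u0 => [//|l u'] _; rewrite /alternating /= !rcons_path.
Qed.

Variable c : K.
Hypothesis b_moments : forall n,
  phi (b ^+ n.+1) = phi (b ^+ n) + c * \sum_(j < n) phi (b ^+ j) * phi (b ^+ (n - j)).

Lemma phi_mul_b_poly p :
  phi (letter (false, 'X * p)) = phi (letter (false, p)) +
    c * \sum_(i < size p) p`_i * \sum_(j < i) phi (b ^+ j) * phi (b ^+ (i - j)).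
Proof.
rewrite /letter /= rmorphM /= horner_algX -/(letter (false, p)) letter_sum mulr_sumr.
rewrite !linear_sum mulr_sumr -big_split; apply: eq_bigr => i _ /=.
by rewrite -scalerAr -exprS !linearZ /= b_moments; ring.
Qed.

(** By linearity the pair may come from an alternating centered word. There [phi_left_letter]
    detaches the leading letter in [b], and the moment recursion of [b] finishes. *)
Lemma free_poisson_span v : alternating_span v ->
  phi (x * b * v.1) = phi (x * v.1) + c * phi v.2.
Proof.
elim=> [w aw cw|k u {}v _ IHu _ IHv]; last first.
  rewrite /= !mulrDr !linearD /= -!scalerAr !linearZ /= IHu IHv; ring.
have bX : b = letter (false, 'X) by rewrite /letter /= horner_algX.
have phib : phi b = 1 by have := b_moments 0; rewrite expr0 big_ord0 mulr0 addr0 phi1.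
rewrite fst_word_act -mulrA.
case: w aw cw => [|[[] p] w] aw cw.
(* If no letter in [b] leads the word, the new [b] comes out with [phi b = 1], and [phi] vanishes on
   the second component. *)
- by rewrite {1}bX phi_left_letter // -bX phib mul1r /= linear0 mulr0 addr0.
- rewrite {1}bX phi_left_letter // -bX phib mul1r.
  rewrite [(word_act _).2]snd_poly_act_a.
  have := @phi_prefix_snd w [:: (true, p)] isT aw cw; rewrite big_seq1 => ->.
  by rewrite mulr0 addr0.
(* The new [b] merges with the first letter into ['X * p]; under [phi] only the splittings inside
   that letter survive. *)
rewrite big_cons [b * _]mulrA; have cw' : centered w by case/andP: cw.
have -> : b * letter (false, p) = letter (false, 'X * p).
  by rewrite /letter /= rmorphM /= horner_algX.
rewrite !phi_left_letter // ?(alternating_head _ _ p) //.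
rewrite [(word_act _).2]snd_poly_act_b linearD /=.
have := @phi_prefix_snd w [:: (false, p)] isT aw cw; rewrite big_seq1 => ->.
rewrite add0r phi_mul_b_poly mulrDl; congr (_ + _).
rewrite -mulrA; congr (_ * _); rewrite /diff_poly /letter /= !linear_sum mulr_suml.
apply: eq_bigr => i _; rewrite linearZ /= mulr_algl linearZ /= -mulrA; congr (_ * _).
rewrite !linear_sum mulr_suml; apply: eq_bigr => j _.
rewrite linearZ /= mulr_algl linearZ /= rmorphXn /= horner_algX.
have bj : b ^+ j = letter (false, 'X^j) by rewrite /letter /= rmorphXn /= horner_algX.
rewrite fst_word_act bj phi_left_letter ?(alternating_head _ _ p) // -bj.
by rewrite mulrAC.
Qed.

Lemma free_poisson_rec n : phi (x * b * (a * b) ^+ n) =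
  phi (x * (a * b) ^+ n) +
  c * \sum_(j < n) phi ((a * b) ^+ j.+1) * phi (x * (a * b) ^+ (n - j.+1)).
Proof.
(* Splitting [(a b)^n] at an occurrence of [b] gives [y' b = (a b)^(j+1)] and [y'' = (a b)^(n-j-1)];
   the orbit of [(1, 0)] records these. *)
pose v n := iter n (hat true \o hat false) (1, 0).
have v1 m : (v m).1 = (a * b) ^+ m.
  by elim: m => [|m IH] //; rewrite /v iterS /= IH exprS mulrA.
have v2 m : (v m).2 = \sum_(j < m) phi (x * (a * b) ^+ (m - j.+1)) *: (a * b) ^+ j.+1.
  elim: m => [|m IH]; first by rewrite big_ord0.
  rewrite /v iterS /= -/(v m) IH v1 big_ord_recl subn1 mulrDr addrC -scalerAr expr1.
  congr (_ + _); rewrite mulrA mulr_sumr; apply: eq_bigr => j _.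
  by rewrite -scalerAr -exprS.
have vs : alternating_span (v n).
  elim: n => [|n IH]; first exact: (@alternating_span_word [::]).
  by rewrite /v iterS; do 2 apply: alternating_span_hat.
rewrite -v1 free_poisson_span // v1 v2 linear_sum; congr (_ + _ * _).
by apply: eq_bigr => j _; rewrite linearZ /= mulrC.
Qed.

End LeftFactor.

Lemma free_poisson_cumulant_sum (c : K) :
  (forall n, phi (b ^+ n.+1) =
     phi (b ^+ n) + c * \sum_(j < n) phi (b ^+ j) * phi (b ^+ (n - j))) ->
  forall n, cumulant_sum (fun k => c * phi (a ^+ k)) n.+1 = c * phi ((a * b) ^+ n.+1).
Proof.
move=> b_moments n.
(* [M 0] must be [1], the sum over the empty partition, and not [c * phi 1]. *)
pose M n := if n is 0 then 1 else c * phi ((a * b) ^+ n).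
rewrite (@cumulant_sum_unique _ _ M (fun n k => c * phi (a ^+ k * (a * b) ^+ n.+1))) //.
  by move=> m; rewrite mul1r.
move=> {}n k; set x := a ^+ k.+1.
have xE : x = letter (true, 'X^(k.+1)) by rewrite /letter /= rmorphXn /= horner_algX.
have -> : a ^+ k * (a * b) ^+ n.+1 = x * b * (a * b) ^+ n by rewrite exprS /x exprSr !mulrA.
have -> : \sum_(j < n) M j * (c * phi (x * (a * b) ^+ (n - j.+1).+1)) =
          \sum_(j < n) M j * (c * phi (x * (a * b) ^+ (n - j))).
  by apply: eq_bigr => j _; rewrite subnSK.
(* The cumulant term is the missing index [j = n] of the sum; once it is absorbed, the index [0] is
   split off instead, as in [free_poisson_rec]. *)
have -> : c * phi x * M n = M n * (c * phi (x * (a * b) ^+ (n - n))).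
  by rewrite subnn mulr1 mulrC.
rewrite addrC -(big_ord_recr n (fun j => M j * (c * phi (x * (a * b) ^+ (n - j))))).
rewrite big_ord_recl /= mul1r subn0 xE (free_poisson_rec _ b_moments) mulrDr; congr (_ + _).
rewrite mulrA mulr_sumr; apply: eq_bigr => j _.
by rewrite /bump /= add1n; ring.
Qed.

End FreePair.

(* Boxed convolution with [Zeta] as a moment-cumulant sum *)
From mathcomp Require Import complex.
From mathcomp Require Import all_classical all_reals all_analysis.
Local Open Scope ring_scope.
Local Open Scope complex_scope.

Theorem theorem2p1 (R : realType) (mu : probability (measurableTypeR R) R)
    (c : R) (mu_c : probability (measurableTypeR R) R) (p : nat -> R[i]) :
  compactly_supported mu -> 0 < c -> is_marchenko_pastur c mu_c ->
  is_free_mul_conv mu mu_c p ->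
  boxed_conv (scale_series c%:C (moment_series (cmoment mu))) (zeta_series R[i])
  = scale_series c%:C (moment_series p).
Proof.
move=> _ _ [_ kappa_c] [A [phi [a [b [phi1 free_ab mom_a mom_b mom_ab]]]]].
apply/funext => -[|n]; first by rewrite /boxed_conv /scale_series /= mulr0.
rewrite /boxed_conv /scale_series /= [moment_series p _]/moment_series /= -mom_ab.
pose m k := cumulant_sum (fun k => c ^+ k.-1) k.
have mE k : phi (b ^+ k) = (m k)%:C.
  case: k => [|k]; first by rewrite expr0 phi1 /m cumulant_sum0.
  by rewrite mom_b /cmoment kappa_c.
have mom_rec k : phi (b ^+ k.+1) = phi (b ^+ k) +
    c%:C * \sum_(j < k) phi (b ^+ j) * phi (b ^+ (k - j)).
  rewrite !mE /m geometric_cumulant_sum_rec rmorphD rmorphM; congr (_ + _ * _).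
  by rewrite [LHS]rmorph_sum; apply: eq_bigr => j _; rewrite !mE; apply: rmorphM.
rewrite -(free_poisson_cumulant_sum phi1 free_ab mom_rec).
apply: eq_bigr => P PN.
have block_gt0 Q (B : {set 'I_n.+1}) : Q \in NC n.+1 -> B \in Q -> #|B| != 0%N.
  rewrite inE => /andP[/and3P[_ _ Q0] _] BQ.
  by rewrite cards_eq0; apply: contraNneq Q0 => <-.
have KN : kreweras P \in NC n.+1 by case/and3P: (krewerasP PN).
(* Blocks are nonempty, so [zeta_series] is [1] on every block of the Kreweras complement and only
   the product over [P] remains. *)
rewrite [X in _ * X]big1 ?mulr1 => [|C CK]; last by rewrite /zeta_series (block_gt0 _ _ KN CK).
apply: eq_bigr => B BP.
by rewrite /moment_series (negPf (block_gt0 _ _ PN BP)) mom_a.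
Qed.
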